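(* Let $\mathbb{F}$ be a field and $X=\{x_{ij}:1\le i,j\le n\}$ noncommuting variables. The Moore determinant $\mathrm{Mdet}_n(X)$ can be computed by polynomial-size (in $n$) noncommutative arithmetic circuits over $\mathbb{F}$ if and only if the Moore permanent $\mathrm{Mperm}_n(X)$ can be computed by polynomial-size noncommutative arithmetic circuits over $\mathbb{F}$.
   Context: For $\sigma\in S_n$, write $\sigma$ as a product of disjoint cycles $(c_{11}\cdots c_{1l_1})\cdots(c_{r1}\cdots c_{rl_r})$ (fixed points included) with each cycle starting at its smallest element and $c_{11}>c_{21}>\cdots>c_{r1}$; let $w_\sigma=\prod_{i=1}^r\big(x_{c_{i1},c_{i2}}\cdots x_{c_{il_i},c_{i1}}\big)$ with the factors in the order $i=1,\ldots,r$. Then $\mathrm{Mdet}_n(X)=\sum_{\sigma\in S_n}\mathrm{sgn}(\sigma)w_\sigma$ and $\mathrm{Mperm}_n(X)=\sum_{\sigma\in S_n}w_\sigma$. A noncommutative arithmetic circuit over $\mathbb{F}$ is a directed acyclic graph with leaves labelled by variables or field elements and internal fan-in-two addition and multiplication gates (multiplication with ordered left/right children), computing a polynomial in the free noncommutative polynomial ring at a designated output; size is the number of nodes. *)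

(* Defs.v *)
From HB Require Import structures.
From mathcomp Require Import all_boot all_order all_fingroup all_algebra.
From mathcomp.multinomials Require Import monalg.

Set Implicit Arguments.
Unset Strict Implicit.
Unset Printing Implicit Defensive.

Import GRing.Theory.
Local Open Scope ring_scope.

(* The free noncommutative polynomial ring F<x_ij : i, j in 'I_n>, as the     *)
(* algebra of the free monoid (words, i.e. concatenated sequences) on the     *)
(* alphabet 'I_n * 'I_n.  Indices run over 0..n-1 instead of 1..n.            *)
Definition ncpoly (F : fieldType) (n : nat) : nzRingType :=
  {malg F[{fmonom ('I_n * 'I_n)%type}]}.

Definition ncvar (F : fieldType) (n : nat) (i j : 'I_n) : ncpoly F n :=
  << fmu (i, j) >>.

Section Moore.
Variables (F : fieldType) (n : nat).

Definition cycle_min (s : 'S_n) (i : 'I_n) : bool :=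
  [forall j in porbit s i, (i <= j)%N].

(* orbit s c = [:: c; s c; s (s c); ...] is the cycle of s through c, listed  *)
(* from c.  Both products are over sequences, hence ordered: the outer one    *)
(* runs through the least elements of the cycles in decreasing order.         *)
Definition moore_word (s : 'S_n) : ncpoly F n :=
  \prod_(c <- rev (enum 'I_n) | cycle_min s c)
    \prod_(i <- fingraph.orbit s c) ncvar F i (s i).

Definition Mdet : ncpoly F n := \sum_(s : 'S_n) (-1) ^+ s * moore_word s.

Definition Mperm : ncpoly F n := \sum_(s : 'S_n) moore_word s.

End Moore.

Arguments Mdet F n : clear implicits.
Arguments Mperm F n : clear implicits.

Section Circuits.
Variables (F : fieldType) (n : nat).

Inductive gate (V : Type) : Type :=
| Var of 'I_n & 'I_n
| Const of F
| Add of V & V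
| Mul of V & V.

Definition wire (V : eqType) (g : V -> gate V) (v u : V) : bool :=
  match g v with
  | Add l r | Mul l r => (u == l) || (u == r)
  | _ => false
  end.

(* wire g v u holds when u feeds the gate v; since multiplication gates have  *)
(* ordered children, the graph is given by the labelling g itself.            *)
Record circuit : Type := Circuit {
  node : finType;
  label : node -> gate node;
  output : node;
  no_dicycle : forall c : seq node, path.cycle (wire label) c -> c = [::]
}.

Definition circuit_size (C : circuit) : nat := #|node C|.

Definition gate_val (V : Type) (val : V -> ncpoly F n) (g : gate V) :
    ncpoly F n :=
  match g with
  | Var i j => ncvar F i j
  | Const a => a%:MP
  | Add l r => val l + val r
  | Mul l r => val l * val r
  end.

Definition computes (C : circuit) (f : ncpoly F n) : Prop :=
  exists2 val : node C -> ncpoly F n,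
    forall v, val v = gate_val val (label v) & val (output C) = f.

(* Acyclicity makes the gate equations uniquely solvable.                     *)
Lemma wire_wf (C : circuit) (P : node C -> Prop) :
  (forall v, (forall u, wire (@label C) v u -> P u) -> P v) -> forall v, P v.
Proof.
move=> IH v; pose e := wire (@label C).
have [m] := ubnP #|connect e v|; elim: m v => // m IHm v lem; apply: IH => u evu.
apply: IHm; rewrite ltnS in lem; apply: leq_trans lem.
apply/proper_card/properP; split.
  by apply/subsetP=> w; apply: connect_trans; exact: connect1.
exists v; first exact: connect0.
apply/negP=> /connectP[p ep lp].
suff /no_dicycle : path.cycle e (u :: p) by [].
by rewrite /= rcons_path ep -lp.
Qed.

Lemma computes_exists_unique (C : circuit) : exists! f, computes C f.
Proof.
pose ev := fix ev k (v : node C) {struct k} : ncpoly F n :=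
  if k is k'.+1 then gate_val (ev k') (label v) else 0.
have eqv (x y : node C -> ncpoly F n) (v : node C) :
    (forall u, wire (@label C) v u -> x u = y u) ->
  gate_val x (label v) = gate_val y (label v).
  rewrite /wire; case: (label v) => [i j|a|l r|l r] xy /=.
  - exact: erefl.
  - exact: erefl.
  - have -> : x l = y l by apply: xy; rewrite eqxx.
    have -> : x r = y r by apply: xy; rewrite eqxx orbT.
    exact: erefl.
  - have -> : x l = y l by apply: xy; rewrite eqxx.
    have -> : x r = y r by apply: xy; rewrite eqxx orbT.
    exact: erefl.
have stab v : exists m, forall k, (m <= k)%N -> ev k v = ev m v.
  elim/(@wire_wf C): v => v IHv.
  have [M HM] : exists M, forall u, wire (@label C) v u ->
      forall k, (M <= k)%N -> ev k u = ev M u.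
    rewrite /wire in IHv *; case: (label v) IHv => [i j|a|l r|l r] IHv;
      try by exists 0%N.
    - have [|a Ha] := IHv l; first by rewrite eqxx.
      have [|b Hb] := IHv r; first by rewrite eqxx orbT.
      exists (maxn a b) => u /orP[]/eqP-> k; rewrite geq_max => /andP[ak bk].
        by rewrite Ha // Ha // leq_maxl.
      by rewrite Hb // Hb // leq_maxr.
    - have [|a Ha] := IHv l; first by rewrite eqxx.
      have [|b Hb] := IHv r; first by rewrite eqxx orbT.
      exists (maxn a b) => u /orP[]/eqP-> k; rewrite geq_max => /andP[ak bk].
        by rewrite Ha // Ha // leq_maxl.
      by rewrite Hb // Hb // leq_maxr.
  exists M.+1; case=> [|k]; first by rewrite ltn0.
  rewrite ltnS => Mk; rewrite -/(gate_val (ev k) _) -/(gate_val (ev M) _).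
  by apply: eqv => u vu; exact: HM.
have [M HM] : exists M, forall v k, (M <= k)%N -> ev k v = ev M v.
  have [M HM] : exists M, forall v, v \in enum (node C) ->
      forall k, (M <= k)%N -> ev k v = ev M v.
    elim: (enum _) => [|v s [M HM]]; first by exists 0%N.
    have [m Hm] := stab v; exists (maxn m M) => u.
    rewrite inE => /orP[/eqP->|us] k; rewrite geq_max => /andP[mk Mk].
      by rewrite Hm // Hm // leq_maxl.
    by rewrite HM // HM // leq_maxr.
  by exists M => v; apply: HM; rewrite mem_enum.
have evE v : ev M v = gate_val (ev M) (label v).
  exact: etrans (esym (HM v M.+1 (leqnSn M))) (erefl _).
exists (ev M (output C)); split; first by exists (ev M); [exact: evE|].
move=> f [val Hval <-]; elim/(@wire_wf C): (output C) => v IHv.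
by rewrite (Hval v) evE; exact: eqv.
Qed.

End Circuits.

(* A family (f n)_n has noncommutative circuits of size polynomial in n.      *)
Definition poly_size_computable (F : fieldType) (f : forall n, ncpoly F n) :
    Prop :=
  exists p : {poly nat}, forall n : nat,
    exists2 C : circuit F n, (circuit_size C <= p.[n])%N & computes C (f n).

(* Main.v *)
(** Reading the word of a permutation from left to right, a deterministic
automaton can remember the first index of the cycle being read and recognise
the letter closing it.  Giving the sign -1 to every letter that does not close
a cycle of length l multiplies the cycle by (-1)^(l-1), hence the word of s by
sgn s.  Substituting x_ij * M_ij for x_ij, where M_ij is the (n+1) x (n+1)
transition matrix of the automaton weighted by these signs, therefore exchanges
the Moore determinant and the Moore permanent in the entry indexed by the
initial state.  A circuit for f yields one for the entries of the substituted
matrix, each gate being replaced by the (n+1)^2 entries of its matrix value. *)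

From HB Require Import structures.
Require Import Defs.
From mathcomp Require Import all_boot all_order all_fingroup all_algebra zify.
From mathcomp.multinomials Require Import monalg.

Set Implicit Arguments.
Unset Strict Implicit.
Unset Printing Implicit Defensive.

Import GRing.Theory.
Local Open Scope ring_scope.

(** * Substituting weighted matrices for the variables *)

Section MatrixSubstitution.
Variables (F : fieldType) (n N : nat) (lam : 'I_n -> 'I_n -> 'M[F]_N.+1).

Lemma malgC_comm (c : F) (g : ncpoly F n) : GRing.comm c%:MP g.
Proof.
rewrite /GRing.comm mul_malgC malgM_def fgmulgU malgZ_def.
by apply: eq_bigr => k _; rewrite mulm1 mulrC.
Qed.

Definition letter_mx (x : 'I_n * 'I_n) : 'M[ncpoly F n]_N.+1 :=
  \matrix_(a, b) ((lam x.1 x.2 a b)%:MP * ncvar F x.1 x.2).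

Definition word_mx (w : {fmonom ('I_n * 'I_n)%type}) : 'M[ncpoly F n]_N.+1 :=
  \prod_(x <- (w : seq _)) letter_mx x.

Fact word_mx_multiplicative : mmorphism word_mx.
Proof.
split; last by rewrite /word_mx fm1 big_nil.
by move=> u v; rewrite /word_mx fmM big_cat.
Qed.

HB.instance Definition _ :=
  isMultiplicative.Build _ _ word_mx word_mx_multiplicative.

Definition const_scalar_mx : F -> 'M[ncpoly F n]_N.+1 :=
  scalar_mx \o (fun c : F => c%:MP : ncpoly F n).

HB.instance Definition _ := GRing.RMorphism.on const_scalar_mx.

Definition mx_subst : ncpoly F n -> 'M[ncpoly F n]_N.+1 :=
  mmap const_scalar_mx word_mx.

(** Extending a monoid morphism linearly into a noncommutative ring respects products once the
    images of the coefficients commute with everything; here they are scalar matrices of constants,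
    and constants are central. *)
Fact mx_subst_multiplicative : multiplicative mx_subst.
Proof.
apply: commr_mmap_is_multiplicative => g m m'.
rewrite /GRing.comm; apply/matrixP => a b.
rewrite -!mulmxE mul_scalar_mx !mxE (bigD1 b) //= big1 ?addr0 => [|c /negPf cb].
  by rewrite mxE eqxx malgC_comm.
by rewrite mxE cb mulr0.
Qed.

HB.instance Definition _ := GRing.Additive.on mx_subst.
HB.instance Definition _ :=
  GRing.isMultiplicative.Build _ _ mx_subst mx_subst_multiplicative.

Lemma mx_subst_const (c : F) : mx_subst c%:MP = const_scalar_mx c.
Proof. exact: mmapC. Qed.

Lemma mx_subst_var i j : mx_subst (ncvar F i j) = letter_mx (i, j).
Proof.
rewrite /mx_subst mmapU /= (rmorph1 const_scalar_mx) mul1r.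
by rewrite /word_mx fmU big_seq1.
Qed.

End MatrixSubstitution.

(** * Acyclicity by rank functions *)

Lemma cycle_of_rank (T : Type) (e : rel T) (rank : T -> nat) (c : seq T) :
  (forall v u, e v u -> (rank u < rank v)%N) -> path.cycle e c -> c = [::].
Proof.
move=> dec; case: c => [//|x p] /= ep.
have gtn_rank_trans : transitive (fun v u => rank u < rank v)%N.
  by move=> y z t zy yt; apply: ltn_trans yt zy.
have /(order_path_min gtn_rank_trans) := sub_path dec ep.
by rewrite all_rcons ltnn.
Qed.

(** The rank of [v] counts the nodes reachable from [v]. It drops along a wire from [v] to [u],
    because acyclicity prevents [u] from reaching [v] again. *)
Lemma circuit_rank (F : fieldType) (n : nat) (C : circuit F n) :
  exists rank : node C -> nat,
    forall v u, wire (@label _ _ C) v u -> (rank u < rank v)%N.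
Proof.
pose e := wire (@label _ _ C).
exists (fun v => #|connect e v|) => v u evu.
apply/proper_card/properP; split.
  by apply/subsetP=> w; apply: connect_trans; apply: connect1.
exists v; first exact: connect0.
apply/negP=> /connectP[p ep lp].
suff /no_dicycle : path.cycle e (u :: p) by [].
by rewrite /= rcons_path ep -lp.
Qed.

(** * The automaton on Moore words and the sign of a permutation *)

Section MooreWords.
Variable n : nat.
Implicit Types (s : 'S_n) (c : 'I_n).

(* [None] is the state between two cycles, [Some c] the state inside a cycle
   that starts at c. *)
Definition next_state (q : option 'I_n) (x : 'I_n * 'I_n) : option 'I_n :=
  if x.2 == odflt x.1 q then None else Some (odflt x.1 q).

Definition step_sign (q : option 'I_n) (x : 'I_n * 'I_n) : bool :=
  x.2 != odflt x.1 q.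

Definition run : option 'I_n -> seq ('I_n * 'I_n) -> option 'I_n :=
  foldl next_state.

Fixpoint run_sign (q : option 'I_n) (w : seq ('I_n * 'I_n)) : bool :=
  if w is x :: w' then step_sign q x (+) run_sign (next_state q x) w'
  else false.

Lemma run_sign_cat q u v :
  run_sign q (u ++ v) = run_sign q u (+) run_sign (run q u) v.
Proof. by elim: u q => //= x u IHu q; rewrite IHu addbA. Qed.

Definition cycle_letters s c : seq ('I_n * 'I_n) :=
  [seq (i, s i) | i <- fingraph.orbit s c].

(** Iterates of [c] return to [c] only after [order s c] steps, so exactly the last letter closes
    the cycle and each earlier one contributes a sign. *)
Lemma run_cycle s c :
  run None (cycle_letters s c) = None /\
  run_sign None (cycle_letters s c) = odd (fingraph.order s c).-1.
Proof.
(* Induction on suffixes of the cycle. The condition on [odflt] covers both the start, where [q] is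
   [None] and [k] is 0, and the later states [Some c]. *)
have gen m : forall k q, (k + m.+1 = fingraph.order s c)%N ->
    odflt (iter k s c) q = c ->
    let w := [seq (i, s i) | i <- traject s (iter k s c) m.+1] in
    run q w = None /\ run_sign q w = odd m.
  elim: m => [|m IHm] k q km qc.
    rewrite /= /next_state /step_sign /= qc -iterS -addn1 km.
    by rewrite (iter_order perm_inj) eqxx.
  have skc : s (iter k s c) != c.
    rewrite -iterS; apply/eqP => skc.
    have klt : (k.+1 < fingraph.order s c)%N by rewrite -km -addn1 ltn_add2l.
    by have := findex_iter klt; rewrite skc findex0.
  have [] := IHm k.+1 (Some c); [by rewrite addSnnS | by [] |].
  rewrite /= /next_state /step_sign /= qc (negPf skc) => -> ->.
  by split.
rewrite /cycle_letters /fingraph.orbit -orderSpred.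
by apply: (gen _ 0%N); rewrite ?orderSpred.
Qed.

Definition cycle_mins s : seq 'I_n := [seq c <- rev (enum 'I_n) | cycle_min s c].

Definition moore_letters s : seq ('I_n * 'I_n) :=
  flatten [seq cycle_letters s c | c <- cycle_mins s].

Lemma moore_wordE (F : fieldType) s :
  moore_word F s = \prod_(x <- moore_letters s) ncvar F x.1 x.2.
Proof.
rewrite /moore_word -big_filter /moore_letters big_flatten big_map.
by apply: eq_bigr => c _; rewrite big_map.
Qed.

Lemma porbit_cycle_min s c : exists2 m, cycle_min s m & porbit s c = porbit s m.
Proof.
have [m mc min_m] :=
  @arg_minnP _ c [in porbit s c] (fun i : 'I_n => i : nat) (porbit_id s c).
exists m; last by apply/esym/eqP; rewrite eq_porbit_mem.
move: (mc); rewrite -eq_porbit_mem => /eqP smc.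
by apply/forall_inP => j; rewrite smc; apply: min_m.
Qed.

Lemma porbit_cycle_min_inj s : {in cycle_min s &, injective (porbit s)}.
Proof.
move=> x y /forall_inP xmin /forall_inP ymin xy; apply/val_inj/eqP.
by rewrite eqn_leq xmin ?ymin // ?xy ?porbit_id // -xy porbit_id.
Qed.

(** Every orbit has a least element, so the cycle minima form a transversal of the orbits. *)
Lemma porbits_cycle_min s : porbits s = [set porbit s c | c in cycle_min s].
Proof.
apply/setP => A; apply/imsetP/imsetP => -[c cP ->].
  by have [m mP ->] := porbit_cycle_min s c; exists m.
by exists c.
Qed.

Lemma order_porbit s c : fingraph.order s c = #|porbit s c|.
Proof.
apply: eq_card => x; rewrite [LHS]inE.
apply/idP/porbitP => [/iter_findex <-|[k ->]].
  by exists (findex s c x); rewrite permX.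
by rewrite permX fconnect_iter.
Qed.

Lemma sum_order_cycle_min s :
  (\sum_(c | cycle_min s c) fingraph.order s c = n)%N.
Proof.
rewrite -[RHS]card_ord -sum1_card [RHS](partition_big_imset (porbit s)) /=.
rewrite -/(porbits s) porbits_cycle_min big_imset /=; last first.
  exact: porbit_cycle_min_inj.
apply: eq_bigr => c _; rewrite order_porbit -sum1_card.
by apply: eq_bigl => x; rewrite eq_porbit_mem.
Qed.

(** The cycle lengths add up to n, so the sum is n minus the number of cycles, whose parity is the
    definition of [odd_perm]. *)
Lemma odd_sum_cycle_min s :
  odd (\sum_(c <- cycle_mins s) (fingraph.order s c).-1) = odd_perm s.
Proof.
have -> : (\sum_(c <- cycle_mins s) (fingraph.order s c).-1 =
           \sum_(c | cycle_min s c) (fingraph.order s c).-1)%N.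
  by rewrite /cycle_mins big_filter bigop.big_rev /= big_enum_cond.
have := sum_order_cycle_min s.
under eq_bigr do rewrite -orderSpred -addn1.
rewrite big_split /= sum1_card => /(congr1 odd).
rewrite oddD /odd_perm porbits_cycle_min card_in_imset; last first.
  exact: porbit_cycle_min_inj.
by rewrite card_ord => <-; rewrite -addbA addbb addbF.
Qed.

Lemma run_moore_letters s :
  run None (moore_letters s) = None /\
  run_sign None (moore_letters s) = odd_perm s.
Proof.
rewrite -odd_sum_cycle_min /moore_letters.
elim: (cycle_mins s) => [|c r [IH1 IH2]]; first by rewrite big_nil.
have [c1 c2] := run_cycle s c.
rewrite big_cons oddD /= run_sign_cat c1 c2 IH2; split=> //.
by rewrite /run foldl_cat -!/(run _ _) c1.
Qed.

End MooreWords.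

(** * A circuit for the entries of the substituted matrix *)

Section MatrixCircuit.
Variables (F : fieldType) (n N : nat) (lam : 'I_n -> 'I_n -> 'M[F]_N.+1).
Variable C : circuit F n.

Local Notation state := 'I_N.+1.
Local Notation mx_node := (node C * state * state * ('I_N.+2 + state + bool))%type.
Local Notation partial v a b k := (v, a, b, inl (inl k)) (only parsing).
Local Notation summand v a b c := (v, a, b, inl (inr c)) (only parsing).

(** The index [ord_max] is N+1: at a multiplication gate, all N+1 terms have been added. *)
Definition entry (v : node C) (a b : state) : mx_node := partial v a b ord_max.

(* A node (v, a, b, _) serves the entry (a, b) of the matrix value of v.  At a
   multiplication gate the k-th partial node computes the sum of the first k
   terms of that entry of the matrix product; at any other gate it computes the
   full entry for every k. *)
Definition mx_label (x : mx_node) : gate F n mx_node :=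
  let: (v, a, b, t) := x in
  match label v, t with
  | Var i j, inr true => Const _ _ (lam i j a b)
  | Var i j, inr false => Var _ _ i j
  | Var _ _, inl _ => Mul _ _ (v, a, b, inr true) (v, a, b, inr false)
  | Const c, _ => Const _ _ (if a == b then c else 0)
  | Add l r, inl _ => Add _ _ (entry l a b) (entry r a b)
  | Mul l r, inl (inl k) =>
      if unlift ord0 k is Some c
      then Add _ _ (partial v a b (widen_ord (leqnSn _) c)) (summand v a b c)
      else Const _ _ 0
  | Mul l r, inl (inr c) => Mul _ _ (entry l a c) (entry r c b)
  | _, inr _ => Const _ _ 0
  end.

(** Among the nodes over one fixed [v], wires go from lower to higher stage: factors, then summands,
    then partial sums by length. *)
Definition stage (t : 'I_N.+2 + state + bool) : nat :=
  match t with inl (inl k) => k.+2 | inl (inr _) => 1 | inr _ => 0 end.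

Lemma stage_lt t : (stage t < N.+4)%N.
Proof. by case: t => [[k|c]|b] //=; rewrite !ltnS -ltnS. Qed.

Lemma mx_circuit_acyclic (c : seq mx_node) :
  path.cycle (wire mx_label) c -> c = [::].
Proof.
have [rank dec] := circuit_rank C.
(* The lexicographic order on pairs of rank and stage, in base N+4, which exceeds every stage. *)
pose mx_rank (x : mx_node) := (rank x.1.1.1 * N.+4 + stage x.2)%N.
apply: (cycle_of_rank (rank := mx_rank)) => -[[[v a] b] t] [[[u a'] b'] t'].
have lower : wire (@label _ _ C) v u ->
    (mx_rank (u, a', b', t') < mx_rank (v, a, b, t))%N.
  move=> /dec vu; rewrite /mx_rank /=.
  have h : (rank u * N.+4 + stage t' < (rank u).+1 * N.+4)%N.
    by rewrite mulSn addnC ltn_add2r stage_lt.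
  apply: leq_trans h _; apply: leq_trans (leq_addr _ _).
  by rewrite leq_mul2r vu orbT.
have same : u = v -> (stage t' < stage t)%N ->
    (mx_rank (u, a', b', t') < mx_rank (v, a, b, t))%N.
  by move=> -> tt; rewrite /mx_rank /= ltn_add2l.
move: lower; rewrite /wire /=; case: (label v) => [i j|k|l r|l r] lower.
- case: t same {lower} => [[k|k]|[]] //= same /orP[]/eqP[eu _ _ et]; apply: same;
    by rewrite ?et.
- by [].
- case: t same lower => [t|t] //= same lower.
  by case/orP=> /eqP[eu _ _ _]; apply: lower; rewrite eu eqxx ?orbT.
- case: t same lower => [[k|k]|t] //= same lower.
    case: unliftP => [d kd|//] /orP[]/eqP[eu _ _ et]; apply: same => //.
      by rewrite et kd /= /bump.
    by rewrite et.
  by case/orP=> /eqP[eu _ _ _]; apply: lower; rewrite eu eqxx ?orbT.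
Qed.

Definition mx_circuit (v : node C) (a b : state) : circuit F n :=
  {| node := mx_node; label := mx_label; output := entry v a b;
     no_dicycle := mx_circuit_acyclic |}.

Lemma mx_circuit_size v a b :
  circuit_size (mx_circuit v a b) = (circuit_size C * N.+1 ^ 2 * (N.*2 + 5))%N.
Proof.
(* The factor 2N+5 counts N+2 partial sums, N+1 summands and 2 boolean nodes. *)
rewrite /circuit_size /= !card_prod !card_sum !card_ord card_bool.
by rewrite -!mulnA; congr (_ * (_ * (_ * _)))%N; lia.
Qed.

Lemma mx_circuit_computes (f : ncpoly F n) a b :
  computes C f -> computes (mx_circuit (output C) a b) (mx_subst lam f a b).
Proof.
case=> val valE <-.
pose Phi v := mx_subst lam (val v).
pose mx_val (x : mx_node) : ncpoly F n :=
  let: (v, a, b, t) := x in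
  match label v, t with
  | Var i j, inr true => (lam i j a b)%:MP
  | Var i j, inr false => ncvar F i j
  | Add _ _, inr _ => 0
  | Mul _ _, inr _ => 0
  | Mul l r, inl (inl k) => \sum_(c < N.+1 | (c < k)%N) Phi l a c * Phi r c b
  | Mul l r, inl (inr c) => Phi l a c * Phi r c b
  | _, _ => Phi v a b
  end.
have entryE v a' b' : mx_val (entry v a' b') = Phi v a' b'.
  rewrite /mx_val /entry; case E: (label v) => [i j|c|l r|l r] //.
  rewrite /Phi (valE v) E /= rmorphM -mulmxE mxE.
  by apply: eq_bigl => c; rewrite ltn_ord.
exists mx_val; last exact: entryE.
move=> [[[v a'] b'] t] /=; case E: (label v) => [i j|c|l r|l r].
- by case: t => [t|[]] //=; rewrite E /Phi (valE v) E /= mx_subst_var mxE.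
- rewrite /Phi (valE v) E /= mx_subst_const !mxE.
  by case: eqP => _; rewrite ?mulr1n ?mulr0n ?raddf0.
- case: t => [t|t] /=; last by rewrite raddf0.
  transitivity (Phi l a' b' + Phi r a' b').
    by rewrite /Phi (valE v) E /= raddfD mxE.
  exact: congr2 (esym (entryE _ _ _)) (esym (entryE _ _ _)).
- case: t => [[k|c]|t] /=; last by rewrite raddf0.
    (* For k = 0 the partial sum is empty; for k = c+1 its term [c] is split off. *)
    case: unliftP => [c ->|->] /=; last by rewrite big_pred0 ?raddf0.
    rewrite E (bigD1 c) /= /bump ?add1n // addrC; congr (_ + _).
    by apply: eq_bigl => d; rewrite ltnS ltn_neqAle andbC.
  exact: congr2 (esym (entryE _ _ _)) (esym (entryE _ _ _)).
Qed.

End MatrixCircuit.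

Lemma poly_size_mx_subst (F : fieldType) (f : forall n, ncpoly F n)
    (lam : forall n, 'I_n -> 'I_n -> 'M[F]_n.+1) :
  poly_size_computable f ->
  poly_size_computable (fun n => mx_subst (lam n) (f n) ord0 ord0).
Proof.
(* This is the size of [mx_circuit] with N = n, read as a polynomial in n. *)
case=> p pP; exists (p * ('X + 1%:P) ^+ 2 * ('X *+ 2 + 5%:P)) => n.
have [C sizeC compC] := pP n.
exists (mx_circuit (lam n) (output C) ord0 ord0); last exact: mx_circuit_computes.
rewrite mx_circuit_size.
rewrite !(hornerM, horner_exp, hornerD, hornerMn, hornerX, hornerC).
rewrite -addnn -[n.+1]addn1.
rewrite !natrE mulnn.
by apply: leq_mul (leqnn _); apply: leq_mul (leqnn _).
Qed.

Lemma mul_signr_mul (R : pzRingType) (a b : bool) (u v : R) :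
  (-1) ^+ a * u * ((-1) ^+ b * v) = (-1) ^+ (a (+) b) * (u * v).
Proof.
by rewrite signr_addb -!mulrA; congr (_ * _); rewrite !mulrA commr_sign.
Qed.

(** * Exchanging the determinant and the permanent *)

Section CycleSign.
Variables (F : fieldType) (n : nat).

(** Index 0 is the state between cycles, so the (0, 0) entry follows runs that start and end
    there. *)
Definition state_ord (q : option 'I_n) : 'I_n.+1 := oapp (lift ord0) ord0 q.

Lemma state_ordK : cancel state_ord (unlift ord0).
Proof. by case=> [i|] /=; rewrite ?liftK ?unlift_none. Qed.

Definition sign_weight (i j : 'I_n) : 'M[F]_n.+1 :=
  \matrix_(a, b) if b == state_ord (next_state (unlift ord0 a) (i, j))
                 then (-1) ^+ step_sign (unlift ord0 a) (i, j) else 0.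

(** The automaton is deterministic: each row of a letter matrix has one nonzero entry, so a single
    run contributes to the product. *)
Lemma letters_mxE q (w : seq ('I_n * 'I_n)) b :
  (\prod_(x <- w) letter_mx sign_weight x) (state_ord q) b =
  if b == state_ord (run q w)
  then (-1) ^+ run_sign q w * \prod_(x <- w) ncvar F x.1 x.2 else 0.
Proof.
elim: w q => [|x w IHw] q.
  by rewrite !big_nil mulr1 /= mxE eq_sym; case: eqP.
rewrite !big_cons -mulmxE mxE (bigD1 (state_ord (next_state q x))) //=.
rewrite big1 ?addr0 => [|c /negPf cq]; last first.
  by rewrite !mxE state_ordK -surjective_pairing cq raddf0 !mul0r.
rewrite IHw !mxE state_ordK -surjective_pairing eqxx rmorph_sign.
case: (_ == _); [exact: mul_signr_mul | exact: mulr0].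
Qed.

Lemma mx_subst_moore_word (s : 'S_n) :
  mx_subst sign_weight (moore_word F s) ord0 ord0 =
  (-1) ^+ s * moore_word F s.
Proof.
rewrite moore_wordE rmorph_prod /=.
under eq_bigr do rewrite mx_subst_var -surjective_pairing.
rewrite (letters_mxE None).
have [-> ->] := run_moore_letters s.
by rewrite eqxx.
Qed.

End CycleSign.

(** An arbitrary [e] serves both directions: [odd_perm] gives the determinant, whose signs cancel,
    and the constant [false] gives the permanent, which acquires them. *)
Lemma mx_subst_signed_sum (F : fieldType) (n : nat) (e : 'S_n -> bool) :
  mx_subst (@sign_weight F n) (\sum_s (-1) ^+ e s * moore_word F s) ord0 ord0 =
  \sum_s (-1) ^+ (e s (+) s) * moore_word F s.
Proof.
rewrite raddf_sum /= summxE; apply: eq_bigr => s _.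
rewrite rmorphM rmorph_sign signr_addb -mulrA -mx_subst_moore_word !mulr_sign.
by case: (e s); rewrite // mxE.
Qed.

Theorem theorem7p2 (F : fieldType) :
  poly_size_computable (Mdet F) <-> poly_size_computable (Mperm F).
Proof.
have ext f g : (forall n, f n = g n :> ncpoly F n) ->
    poly_size_computable f -> poly_size_computable g.
  move=> fg [p pP]; exists p => n; have [C] := pP n.
  by exists C; rewrite -?fg.
split=> /(@poly_size_mx_subst _ _ (@sign_weight F)); apply: ext => n.
  rewrite /Mdet mx_subst_signed_sum /Mperm; apply: eq_bigr => s _.
  by rewrite addbb mul1r.
have -> : Mperm F n = \sum_(s : 'S_n) (-1) ^+ false * moore_word F s.
  by apply: eq_bigr => s _; rewrite mul1r.
exact: mx_subst_signed_sum.
Qed.
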